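(* Let $\mathcal{X}$ be a non-empty set, let $D$ be a set of decisions with gain gambles $J_d$ ($d\in D$), let $\underline{P}$ be a lower prevision on a set $\mathcal{K}$ of gambles on $\mathcal{X}$ that avoids sure loss, let $\mathcal{F}$ be a field of subsets of $\mathcal{X}$ such that all $J_d$ ($d\in D$) and all gambles in $\mathcal{K}$ are $\mathcal{F}$-measurable, and let $\mathcal{M}$ be the credal set of $\underline{P}$, and $\underline{\mathbf{E}}_{\underline{P}}$, $\overline{\mathbf{E}}_{\underline{P}}$ the lower and upper natural extensions of $\underline{P}$. If $\mathcal{J}=\{J_d\colon d\in D\}$ is non-empty and compact with respect to the $\tau$-topology on $\mathcal{L}(\mathcal{X})$, then the following statements hold. (i) $\mathrm{opt}_{\mathbf{E}_\mu}(D)$ is non-empty for all $\mu\in\mathcal{M}$. (ii) $\mathrm{opt}_{\underline{\mathbf{E}}_{\underline{P}}}(D)$ is non-empty. (iii) $\mathrm{opt}_{\overline{\mathbf{E}}_{\underline{P}}}(D)$ is non-empty. (iv) $\mathrm{opt}_{>_{\underline{P}}}(D)$ is non-empty. (v) $\mathrm{opt}_{\sqsupset_{\underline{P}}}(D)$ is non-empty. (vi) $\mathrm{opt}_{\mathcal{M}}(D)$ is non-empty.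
   Context: A gamble on $\mathcal{X}$ is a bounded function $\mathcal{X}\to\mathbb{R}$; $\mathcal{L}(\mathcal{X})$ is the set of all gambles. $D$ is a set and each $d\in D$ has an associated gain gamble $J_d\in\mathcal{L}(\mathcal{X})$. Inequalities between gambles are point-wise. A gamble is $\mathcal{F}$-measurable if it is a uniform limit of $\mathcal{F}$-simple gambles (finite linear combinations of indicators of sets in $\mathcal{F}$). A lower prevision is a real-valued map $\underline{P}$ on a (possibly empty) set $\mathcal{K}\subseteq\mathcal{L}(\mathcal{X})$. It avoids sure loss if there is no finite collection (repetitions allowed) $f_1,\dots,f_n\in\mathcal{K}$ with $\sum_{i=1}^n\underline{P}(f_i)>\sup_{x\in\mathcal{X}}\sum_{i=1}^n f_i(x)$. For a finitely additive probability measure $\mu$ on $\mathcal{F}$, $\mathbf{E}_\mu(f)=\int f\,\mathrm{d}\mu$ is the (Dunford) integral of an $\mathcal{F}$-measurable gamble $f$, i.e. the unique linear, supremum-norm continuous extension of the obvious integral on $\mathcal{F}$-simple gambles. The credal set $\mathcal{M}$ of $\underline{P}$ is the set of all finitely additive probability measures $\mu$ on $\mathcal{F}$ such that $\underline{P}(f)\le\mathbf{E}_\mu(f)$ for all $f\in\mathcal{K}$ (it is non-empty because $\underline{P}$ avoids sure loss). The (lower) natural extension is $$\underline{\mathbf{E}}_{\underline{P}}(g)=\sup\Big\{\alpha+\sum_{i=1}^n\lambda_i\underline{P}(f_i)\colon \alpha+\sum_{i=1}^n\lambda_i f_i\le g\Big\}\qquad(g\in\mathcal{L}(\mathcal{X})),$$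 over $\alpha\in\mathbb{R}$, $n\ge 0$, $\lambda_i\ge 0$, $f_i\in\mathcal{K}$; for $\mathcal{F}$-measurable $g$ it equals $\min_{\mu\in\mathcal{M}}\mathbf{E}_\mu(g)$. The upper natural extension is $\overline{\mathbf{E}}_{\underline{P}}(g)=-\underline{\mathbf{E}}_{\underline{P}}(-g)$. The $\tau$-topology on $\mathcal{L}(\mathcal{X})$ is the topology whose convergence is the following: a net $f_\alpha$ $\tau$-converges to $f$ if and only if $\lim_\alpha f_\alpha(x)=f(x)$ for all $x\in\mathcal{X}$ and $\lim_\alpha\overline{\mathbf{E}}_{\underline{P}}(|f_\alpha-f|)=0$. Equivalently, it is the (Hausdorff) locally convex topology generated by the seminorms $f\mapsto|f(x)|$ ($x\in\mathcal{X}$) and $f\mapsto\overline{\mathbf{E}}_{\underline{P}}(|f|)$. Admissible decisions: $\mathrm{opt}_{\ge}(D)=\{d\in D\colon(\forall e\in D)(J_e\not\ge J_d\text{ or }J_e=J_d)\}$. Optimality operators (an $\arg\max$ is empty if no maximum is attained): - $\mathrm{opt}_{\mathbf{E}_\mu}(D)=\arg\max_{d\in\mathrm{opt}_{\ge}(D)}\mathbf{E}_\mu(J_d)$ (maximal expected utility); - $\mathrm{opt}_{\underline{\mathbf{E}}_{\underline{P}}}(D)=\arg\max_{d\in\mathrm{opt}_{\ge}(D)}\underline{\mathbf{E}}_{\underline{P}}(J_d)$ ($\Gamma$-maximin); - $\mathrm{opt}_{\overline{\mathbf{E}}_{\underline{P}}}(D)=\arg\max_{d\in\mathrm{opt}_{\ge}(D)}\overline{\mathbf{E}}_{\underline{P}}(J_d)$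 ($\Gamma$-maximax); - $\mathrm{opt}_{>_{\underline{P}}}(D)=\{d\in\mathrm{opt}_{\ge}(D)\colon(\forall e\in\mathrm{opt}_{\ge}(D))(\underline{\mathbf{E}}_{\underline{P}}(J_e-J_d)\le 0)\}$ (maximality); - $\mathrm{opt}_{\sqsupset_{\underline{P}}}(D)=\{d\in\mathrm{opt}_{\ge}(D)\colon(\forall e\in\mathrm{opt}_{\ge}(D))(\underline{\mathbf{E}}_{\underline{P}}(J_e)\le\overline{\mathbf{E}}_{\underline{P}}(J_d))\}$ (interval dominance); - $\mathrm{opt}_{\mathcal{M}}(D)=\bigcup_{\mu\in\mathcal{M}}\mathrm{opt}_{\mathbf{E}_\mu}(D)$ (E-admissibility). *)

(* Defs.v *)
From HB Require Import structures.
From mathcomp Require Import all_boot all_order all_algebra.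
From mathcomp Require Import all_classical all_reals all_analysis.

Set Implicit Arguments.
Unset Strict Implicit.
Unset Printing Implicit Defensive.

Import Order.TTheory GRing.Theory Num.Theory.
Import numFieldNormedType.Exports.

Local Open Scope classical_set_scope.
Local Open Scope ring_scope.

Section Gamble.
Variables (X : Type) (R : realType).

Definition bounded_pred : {pred X -> R} := fun f => `[< bounded_fun f >].

Record gamble := Gamble {
  gamble_fun :> X -> R;
  gamble_bounded : gamble_fun \in bounded_pred }.

HB.instance Definition _ := [isSub for gamble_fun].
HB.instance Definition _ := [Choice of gamble by <:].

Lemma bounded_predP (f : X -> R) :
  reflect (exists M, forall x, `|f x| <= M) (f \in bounded_pred).
Proof.
apply: (iffP idP) => [/asboolP bf|[M fM]].
  have [M [_ /(_ (M + 1))]] := bf.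
  by rewrite ltrDl ltr01 => /(_ isT) fM; exists (M + 1) => x; apply: fM.
apply/asboolP; exists M; split; first exact: num_real.
by move=> N MN x _; exact: le_trans (fM x) (ltW MN).
Qed.

Lemma bounded_submod_closed : submod_closed bounded_pred.
Proof.
split; first by apply/bounded_predP; exists 0 => x; rewrite normr0.
move=> a f g /bounded_predP[M fM] /bounded_predP[N gN].
apply/bounded_predP; exists (`|a| * M + N) => x.
apply: (le_trans (ler_normD _ _)); rewrite lerD // normrM.
by rewrite ler_wpM2l.
Qed.

HB.instance Definition _ :=
  GRing.isSubmodClosed.Build R (X -> R) bounded_pred bounded_submod_closed.
HB.instance Definition _ := [SubChoice_isSubLmodule of gamble by <:].

Lemma bounded_norm (f : gamble) : (fun x => `|f x|) \in bounded_pred.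
Proof.
have /bounded_predP[M fM] := gamble_bounded f.
by apply/bounded_predP; exists M => x; rewrite normr_id.
Qed.

Definition abs_gamble (f : gamble) : gamble := Gamble (bounded_norm f).

Definition sup_norm (f : gamble) : R := sup [set `|f x| | x in setT].

Definition ge_gamble (f g : gamble) : Prop := forall x, g x <= f x.

End Gamble.

(* A lower prevision is a pair of a domain K and a function P; only the values
   of P on K are ever used. *)
Section LowerPrevision.
Variables (X : Type) (R : realType).
Variables (K : set (gamble X R)) (P : gamble X R -> R).

Definition avoids_sure_loss : Prop :=
  ~ exists (n : nat) (f : 'I_n -> gamble X R), (forall i, K (f i)) /\
      \sum_(i < n) P (f i) > sup [set \sum_(i < n) f i x | x in setT].

(* The set below is non-empty, and it is bounded above whenever P avoids sure
   loss (and X is non-empty), so that the real-valued sup is the true one. *)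
Definition lower_ext (g : gamble X R) : R :=
  sup [set r | exists (a : R) (n : nat) (l : 'I_n -> R)
                      (f : 'I_n -> gamble X R),
    [/\ forall i, 0 <= l i, forall i, K (f i),
        forall x, a + \sum_(i < n) l i * f i x <= g x &
        r = a + \sum_(i < n) l i * P (f i)]].

Definition upper_ext (g : gamble X R) : R := - lower_ext (- g).

Definition tau_seminorm : set (gamble X R -> R) :=
  [set p | (exists x, p = fun f : gamble X R => `|f x|) \/
           p = fun f : gamble X R => upper_ext (abs_gamble f)].

Definition tau_ball (p : gamble X R -> R) (f : gamble X R) (e : R) :
    set (gamble X R) := [set g | p (g - f) < e].

Definition tau_subbase : set (set (gamble X R)) :=
  [set B | exists p f e, [/\ tau_seminorm p, 0 < e & B = tau_ball p f e]].

End LowerPrevision.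

(* The space of gambles with the topology generated by the family of seminorms
   tau_seminorm K P. *)
Definition tau_gamble (X : Type) (R : realType) (K : set (gamble X R))
  (P : gamble X R -> R) : Type := gamble X R.

HB.instance Definition _ (X : Type) (R : realType) (K : set (gamble X R))
    (P : gamble X R -> R) :=
  Choice.copy (tau_gamble K P) (gamble X R).
HB.instance Definition _ (X : Type) (R : realType) (K : set (gamble X R))
    (P : gamble X R -> R) :=
  isSubBaseTopological.Build (tau_gamble K P) (tau_subbase K P) id.

(* The field of subsets of X is the algebra of sets carried by X, whose members
   are the measurable sets; an algebraOfSetsType is pointed, so X is non-empty.
   The type of contents does not require countable additivity. *)
Section Expectation.
Context (d : measure_display) (X : algebraOfSetsType d) (R : realType).
Implicit Types (f g : gamble X R) (mu : {content set X -> \bar R}).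

Definition simple_repr f (n : nat) (a : 'I_n -> R) (A : 'I_n -> set X) :=
  (forall i, measurable (A i)) /\
  forall x, f x = \sum_(i < n) a i * \1_(A i) x.

Definition simple_gamble f : Prop :=
  exists (n : nat) (a : 'I_n -> R) (A : 'I_n -> set X), simple_repr f a A.

Definition measurable_gamble f : Prop :=
  exists2 s : nat -> gamble X R, forall k, simple_gamble (s k) &
    {uniform, (fun k => s k : X -> R) @ \oo --> (f : X -> R)}.

Definition fa_probability mu : Prop := mu [set: X] = 1%E.

Definition is_dunford_integral mu (E : gamble X R -> R) : Prop :=
  [/\ forall (a : R) f g, measurable_gamble f -> measurable_gamble g ->
        E (a *: f + g) = a * E f + E g,
      forall f, measurable_gamble f -> forall e : R, 0 < e ->
        exists2 r : R, 0 < r & forall g, measurable_gamble g ->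
          sup_norm (g - f) < r -> `|E g - E f| < e &
      forall f n (a : 'I_n -> R) (A : 'I_n -> set X), simple_repr f a A ->
        E f = \sum_(i < n) a i * fine (mu (A i))].

(* For a finitely additive probability mu such an E exists, and it is unique on
   the measurable gambles; its values elsewhere are irrelevant. *)
Definition dunford mu : gamble X R -> R :=
  xget (fun=> 0) [set E | is_dunford_integral mu E].

Definition credal_set (K : set (gamble X R)) (P : gamble X R -> R) :
    set {content set X -> \bar R} :=
  [set mu | fa_probability mu /\ forall f, K f -> P f <= dunford mu f].

End Expectation.

Section Optimality.
Context (d : measure_display) (X : algebraOfSetsType d) (R : realType).
Variables (D : Type) (J : D -> gamble X R).

Definition opt_adm : set D :=
  [set a | forall b, ~ ge_gamble (J b) (J a) \/ J b = J a].

Definition argmax (A : set D) (u : D -> R) : set D :=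
  [set a | A a /\ forall b, A b -> u b <= u a].

Definition opt_meu (mu : {content set X -> \bar R}) : set D :=
  argmax opt_adm (fun a => dunford mu (J a)).

Variables (K : set (gamble X R)) (P : gamble X R -> R).

Definition opt_maximin : set D :=
  argmax opt_adm (fun a => lower_ext K P (J a)).

Definition opt_maximax : set D :=
  argmax opt_adm (fun a => upper_ext K P (J a)).

Definition opt_maximal : set D :=
  [set a | opt_adm a /\
    forall b, opt_adm b -> lower_ext K P (J b - J a) <= 0].

Definition opt_interval : set D :=
  [set a | opt_adm a /\
    forall b, opt_adm b -> lower_ext K P (J b) <= upper_ext K P (J a)].

Definition opt_E_admissible : set D :=
  \bigcup_(mu in credal_set K P) opt_meu mu.

End Optimality.

(* Main.v *)
(* For a functional u that is monotone and satisfies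
   u f - u g <= upper_ext |f - g|, the maximizers of u over the range of J form a
   non-empty tau-compact set.  By Zorn's lemma and compactness (the sets
   {g | g >= f} are tau-closed) this set has a pointwise maximal element, which is
   admissible because u is monotone.  The lower and upper natural extensions and
   the integrals E_mu with mu in the credal set are such functionals.  A maximizer
   of the upper extension is also maximal and interval-dominant, since
   lower_ext (f - g) <= upper_ext f - upper_ext g and lower_ext <= upper_ext.

   The Hahn-Banach theorem applied to the upper natural extension gives a linear
   functional E with P <= E on K, and A |-> E 1_A is then in the credal set.  The
   Dunford integral of a given mu comes from the same theorem, applied to the
   lower prevision 1_A |-> mu A, which avoids sure loss. *)

From HB Require Import structures.
Require Import Defs.
From mathcomp Require Import all_boot all_order all_algebra.
From mathcomp Require Import all_classical all_reals all_analysis.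
From mathcomp Require Import lra.

Set Implicit Arguments.
Unset Strict Implicit.
Unset Printing Implicit Defensive.

Import Order.TTheory GRing.Theory Num.Theory.
Import numFieldNormedType.Exports.

Local Open Scope classical_set_scope.
Local Open Scope ring_scope.

(** * Hahn-Banach theorem for sublinear functionals *)

Section HahnBanach.
Context {R : realType} {V : lmodType R}.
Implicit Types (p q : V -> R) (x y : V).

Definition sublinear p :=
  (forall x y, p (x + y) <= p x + p y) /\
  (forall (t : R) x, 0 <= t -> p (t *: x) <= t * p x).

Lemma sublinear0 p : sublinear p -> p 0 = 0.
Proof.
move=> [pD pZ].
have p0 : p 0 <= 0 by have := pZ 0 0 (lexx _); rewrite scale0r mul0r.
by have := pD 0 0; rewrite addr0; lra.
Qed.

Lemma sublinear_oppr_le p x : sublinear p -> - p (- x) <= p x.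
Proof.
move=> sp; have [pD _] := sp; have := pD x (- x).
by rewrite subrr (sublinear0 sp); lra.
Qed.

Lemma sublinearZ p (t : R) x : sublinear p -> 0 <= t -> p (t *: x) = t * p x.
Proof.
move=> sp; have [_ pZ] := sp; rewrite le_eqVlt => /predU1P[<-|t0].
  by rewrite scale0r mul0r sublinear0.
apply/eqP; rewrite eq_le (pZ _ _ (ltW t0))/=.
have := pZ t^-1 (t *: x); rewrite scalerA mulVf ?gt_eqF// scale1r.
by rewrite invr_ge0 ler_pdivlMl//; apply; exact: ltW.
Qed.

(** Subadditivity at [- x] and [- y] becomes superadditivity at [x] and [y], and a negative scalar
    is reduced to its opposite. *)
Lemma odd_sublinear_linear p : sublinear p -> (forall x, p (- x) = - p x) ->
  linear_for *%R p.
Proof.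
move=> sp pN.
have pD x y : p (x + y) = p x + p y.
  apply/eqP; rewrite eq_le sp.1 /=.
  by have := sp.1 (- x) (- y); rewrite -opprD !pN; lra.
move=> t x y; rewrite pD; congr (_ + _).
have [t0|t0] := leP 0 t; first exact: sublinearZ.
have : p ((- t) *: x) = (- t) * p x by apply: sublinearZ => //; lra.
by rewrite scaleNr pN mulNr => /oppr_inj.
Qed.

Section Shift.
Variables (p : V -> R) (sp : sublinear p) (y : V).

(** The auxiliary functional of the Zorn proof of Hahn-Banach: [t = 1] shows that its value at [- y]
    is at most [- p y], so it lies strictly below [p] there unless [p (- y) = - p y]. *)
Definition sublinear_shift x :=
  inf [set p (x + t *: y) - t * p y | t in [set t | 0 <= t]].

Let shift_lb x : has_lbound
  [set p (x + t *: y) - t * p y | t in [set t | 0 <= t]].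
Proof.
(* By subadditivity [t * p y = p (t *: y) <= p (x + t *: y) + p (- x)]. *)
exists (- p (- x)) => _ [t /= t0 <-].
have := sp.1 (x + t *: y) (- x).
by rewrite addrAC subrr add0r sublinearZ//; lra.
Qed.

Lemma sublinear_shift_le x (t : R) : 0 <= t ->
  sublinear_shift x <= p (x + t *: y) - t * p y.
Proof. by move=> t0; apply: ge_inf => //; exists t. Qed.

Let shift_ge x c : (forall t, 0 <= t -> c <= p (x + t *: y) - t * p y) ->
  c <= sublinear_shift x.
Proof.
move=> cP; apply: lb_le_inf.
  by exists (p (x + 0 *: y) - 0 * p y); exists 0; rewrite /=.
by move=> _ [t t0 <-]; exact: cP.
Qed.

(** Parameters [t] for [x] and [s] for [z] combine to [t + s] for [x + z]; a parameter [s] for [x]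
    becomes [t * s] for [t *: x]. *)
Lemma sublinear_shift_sublinear : sublinear sublinear_shift.
Proof.
split=> [x z|t x].
  rewrite -lerBlDr; apply: shift_ge => t t0.
  rewrite lerBlDr -lerBlDl; apply: shift_ge => s s0.
  rewrite lerBlDl.
  apply: le_trans (sublinear_shift_le (x + z) (addr_ge0 t0 s0)) _.
  have := sp.1 (x + t *: y) (z + s *: y).
  by rewrite addrACA -scalerDl; lra.
rewrite le_eqVlt => /predU1P[<-|t0].
  rewrite mul0r scale0r; have := sublinear_shift_le 0 (lexx 0).
  by rewrite scale0r addr0 (sublinear0 sp) mul0r subrr.
rewrite mulrC -ler_pdivrMr//; apply: shift_ge => s s0.
rewrite ler_pdivrMr//.
have ts0 : 0 <= t * s by rewrite mulr_ge0// ltW.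
apply: le_trans (sublinear_shift_le _ ts0) _.
by rewrite -scalerA -scalerDr (sublinearZ _ sp (ltW t0)); lra.
Qed.

End Shift.

(** Zorn's lemma yields a minimal sublinear functional below [p], and minimality forces
    linearity. *)
Lemma hahn_banach_sublinear p : sublinear p ->
  exists2 e : V -> R, linear_for *%R e & forall x, e x <= p x.
Proof.
move=> sp.
pose T := {q : V -> R | sublinear q /\ forall x, q x <= p x}.
(* The order is reversed, so that the maximal element of Zorn's lemma is a minimal functional; a
   chain is bounded by its pointwise infimum. *)
pose le (q r : T) := `[< forall x, sval r x <= sval q x >].
pose mkT q (Tq : sublinear q /\ forall x, q x <= p x) : T := exist _ q Tq.
have p_in : sublinear p /\ forall x, p x <= p x by [].
have [| | |[m [sm mp]] mmin] := @ZL_preorder T (mkT p p_in) le.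
- by move=> q; apply/asboolP.
- move=> q r s /asboolP qr /asboolP rs; apply/asboolP => x.
  exact: le_trans (rs x) (qr x).
- move=> A totA.
  have [[q0 Aq0]|A0] := pselect (A !=set0); last first.
    by exists (mkT p p_in) => s As; case: A0; exists s.
  pose S x := [set sval q x | q in A].
  have Slb x : has_lbound (S x).
    exists (- p (- x)) => _ [[q [sq qp]] _ <-] /=.
    by have := sublinear_oppr_le x sq; have := qp (- x); lra.
  have Sle (q : T) x : A q -> inf (S x) <= sval q x.
    by move=> Aq; apply: ge_inf => //; exists q.
  have geS x c : (forall q : T, A q -> c <= sval q x) -> c <= inf (S x).
    move=> cP; apply: lb_le_inf; first by exists (sval q0 x), q0.
    by move=> _ [q Aq <-]; exact: cP.
  suff iS : sublinear (fun x => inf (S x)) /\ forall x, inf (S x) <= p x.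
    by exists (mkT _ iS) => q Aq; apply/asboolP => x; exact: Sle.
  split; last by move=> x; apply: le_trans (Sle _ _ Aq0) _; exact: (svalP q0).2.
  split=> [x y|t x t0].
    rewrite -lerBlDr; apply: (geS) => q Aq.
    rewrite lerBlDr -lerBlDl; apply: (geS) => r Ar; rewrite lerBlDl.
    (* The smaller of [q] and [r] is subadditive and bounds both terms from below. *)
    have [/asboolP qr|/asboolP rq] := totA _ _ Aq Ar.
      apply: le_trans (Sle _ _ Ar) _.
      by apply: le_trans ((svalP r).1.1 _ _) _; rewrite lerD2r.
    apply: le_trans (Sle _ _ Aq) _.
    by apply: le_trans ((svalP q).1.1 _ _) _; rewrite lerD2l.
  move: t0; rewrite le_eqVlt => /predU1P[<-|t0].
    rewrite mul0r scale0r; apply: le_trans (Sle _ _ Aq0) _.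
    by rewrite sublinear0//; exact: (svalP q0).1.
  rewrite mulrC -ler_pdivrMr//; apply: (geS) => q Aq.
  rewrite ler_pdivrMr// mulrC; apply: le_trans (Sle _ _ Aq) _.
  by apply: (svalP q).1.2; exact: ltW.
exists m => //; apply: odd_sublinear_linear => // y.
(* A minimal sublinear functional is odd: otherwise shifting it along [y]
   would produce a smaller one. *)
have lem x : sublinear_shift m y x <= m x.
  have := sublinear_shift_le sm y x (lexx 0).
  by rewrite scale0r addr0 mul0r subr0.
have sh_in : sublinear (sublinear_shift m y) /\
    forall x, sublinear_shift m y x <= p x.
  split; first exact: sublinear_shift_sublinear.
  by move=> x; exact: le_trans (lem x) (mp x).
have /(_ _)/asboolP mle := mmin (mkT _ sh_in).
have /= := mle (introT (asboolP _) lem) (- y).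
have := sublinear_shift_le sm y (- y) ler01.
rewrite scale1r addNr sublinear0// mul1r.
by have := sublinear_oppr_le y sm; lra.
Qed.

End HahnBanach.

(** * Maximal elements in compact preordered sets *)

(** The upper sections of a chain form a filter base; by compactness it has a cluster point in [A],
    which lies in all these closed sections and so bounds the chain. Antisymmetry is not assumed, so
    that gambles can also be compared through their value under a functional. *)
Lemma compact_preorder_maximal (T : topologicalType) (A : set T)
    (le : T -> T -> Prop) :
  (forall x, le x x) -> (forall x y z, le x y -> le y z -> le x z) ->
  compact A -> A !=set0 -> (forall x, A x -> closed [set y | le x y]) ->
  exists2 m, A m & forall x, A x -> le m x -> le x m.
Proof.
move=> lexx le_trans cA [a Aa] le_closed.
pose U := {x | A x}.
pose leU (x y : U) := `[< le (sval x) (sval y) >].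
have [| | |m mmax] := @ZL_preorder U (exist _ a Aa) leU.
- by move=> x; apply/asboolP.
- move=> x y z /asboolP xy /asboolP yz; apply/asboolP; exact: le_trans yz.
- move=> C totC.
  have [[c Cc]|C0] := pselect (C !=set0); last first.
    by exists (exist _ a Aa) => s Cs; case: C0; exists s.
  pose B (x : U) := A `&` [set y | le (sval x) y].
  pose F := filter_from C B.
  have FF : ProperFilter F.
    apply: filter_from_proper; last first.
      by move=> x Cx; exists (sval x); split; [exact: svalP | exact: lexx].
    apply: filter_from_filter; first by exists c.
    move=> x y Cx Cy; have [/asboolP xy|/asboolP yx] := totC _ _ Cx Cy.
      exists y => // z [Az /= yz]; split; split => //=.
      exact: le_trans yz.
    exists x => // z [Az /= xz]; split; split => //=.
    exact: le_trans xz.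
  have [|z [Az Fz]] := cA F FF; first by exists c => // z [].
  exists (exist _ z Az) => x Cx; apply/asboolP => /=.
  apply: (le_closed _ (svalP x)) => W /(Fz (B x)) [|y [[_ xy] Wy]].
    by exists x.
  by exists y; split.
exists (sval m) => [|x Ax mx]; first exact: svalP.
by have /asboolP := mmax (exist _ x Ax) (introT (asboolP _) mx).
Qed.

(** * Pointwise operations and the supremum norm on gambles *)

Section GambleOps.
Context {X : Type} {R : realType}.
Implicit Types f g : gamble X R.

Lemma gambleD f g x : (f + g) x = f x + g x. Proof. by []. Qed.
Lemma gambleN f x : (- f) x = - f x. Proof. by []. Qed.
Lemma gambleZ (a : R) f x : (a *: f) x = a * f x. Proof. by []. Qed.

Lemma gamble_ext f g : f =1 g -> f = g.
Proof. by move=> fg; apply: val_inj; exact/funext. Qed.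

Lemma gamble_bound f : exists M, forall x, `|f x| <= M.
Proof. exact/bounded_predP/gamble_bounded. Qed.

Lemma gamble_sum I (r : seq I) (F : I -> gamble X R) x :
  (\sum_(i <- r) F i) x = \sum_(i <- r) F i x.
Proof.
by elim: r => [|i r IH]; rewrite ?big_nil// !big_cons gambleD IH.
Qed.

Lemma cst_gamble_bounded (c : R) : (fun=> c) \in @bounded_pred X R.
Proof. by apply/bounded_predP; exists `|c|. Qed.

Definition cst_gamble c : gamble X R := Gamble (cst_gamble_bounded c).

Lemma sup_norm_ub f x : `|f x| <= sup_norm f.
Proof.
have [M fM] := gamble_bound f.
by apply: ub_le_sup; [exists M => _ [y _ <-] | exists x].
Qed.

Lemma sup_norm_le (x0 : X) f M : (forall x, `|f x| <= M) -> sup_norm f <= M.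
Proof.
by move=> fM; apply: ge_sup; [exists `|f x0|; exists x0 | move=> _ [y _ <-]].
Qed.

End GambleOps.

(** * Natural extensions and dominating linear functionals *)

Section NaturalExtension.
Context {X : pointedType} {R : realType}.
Variables (K : set (gamble X R)) (P : gamble X R -> R).
Hypothesis asl : avoids_sure_loss K P.
Implicit Types f g : gamble X R.

(** With lists instead of indexed families, a gamble is repeated by concatenating copies, as
    [asl_cone] does. *)
Lemma asl_seq (s : seq (gamble X R)) S : (forall f, f \in s -> K f) ->
  (forall x, \sum_(f <- s) f x <= S) -> \sum_(f <- s) P f <= S.
Proof.
move=> sK sS; rewrite leNgt; apply/negP => PS; apply: asl.
exists (size s), (fun i => s`_i); split=> [i|]; first exact/sK/mem_nth.
rewrite -(big_mkord xpredT (fun i => P s`_i)) -(big_nth 0 xpredT P).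
apply: le_lt_trans PS; apply: ge_sup.
  by exists (\sum_(i < size s) s`_i point), point.
move=> _ [x _ <-].
rewrite -(big_mkord xpredT (fun i => (s`_i : gamble X R) x)).
by rewrite -(big_nth 0 xpredT (fun f => f x)).
Qed.

(* The real coefficients [N * l i] are truncated to integers; the error is
   bounded independently of [N]. *)
Lemma asl_cone n (l : 'I_n -> R) (f : 'I_n -> gamble X R) S :
  (forall i, 0 <= l i) -> (forall i, K (f i)) ->
  (forall x, \sum_(i < n) l i * f i x <= S) ->
  \sum_(i < n) l i * P (f i) <= S.
Proof.
move=> l0 fK fS.
pose k (N : nat) i := Num.truncn (N%:R * l i).
pose s N := flatten [seq nseq (k N i) (f i) | i <- enum 'I_n].
have sumE N (g : gamble X R -> R) :
    \sum_(h <- s N) g h = \sum_(i < n) (k N i)%:R * g (f i).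
  rewrite /s big_flatten/= big_map big_enum/=; apply: eq_bigr => i _.
  by rewrite big_nseq iter_addr_0 mulr_natl.
have kN N i (c b : R) : `|c| <= b -> `|(k N i)%:R * c - N%:R * l i * c| <= b.
  move=> cb; rewrite -mulrBl normrM; apply: le_trans cb.
  rewrite ler_piMl// distrC ger0_norm ?subr_ge0 ?truncn_le ?mulr_ge0//.
  by rewrite lerBlDl natr1; exact: ltW (truncnS_gt _).
pose M i := sval (cid (gamble_bound (f i))).
have fM i x : `|f i x| <= M i by exact: svalP (cid (gamble_bound (f i))) x.
(* Truncation loses at most one copy of each [f i], hence at most [M i] in the gambles and
   [|P (f i)|] in the previsions. *)
pose C := \sum_(i < n) M i + \sum_(i < n) `|P (f i)|.
have bnd N : N%:R * (\sum_(i < n) l i * P (f i) - S) <= C.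
  have sP : \sum_(h <- s N) P h <= N%:R * S + \sum_(i < n) M i.
    apply: asl_seq => [h /flattenP[t /mapP[i _ ->]]|x].
      by rewrite mem_nseq => /andP[_ /eqP ->].
    rewrite sumE -lerBlDl; apply: le_trans (_ : _ <= \sum_(i < n)
        ((k N i)%:R * f i x - N%:R * l i * f i x)) _.
      rewrite sumrB lerB// (le_trans _ (ler_wpM2l (ler0n _ N) (fS x)))//.
      by rewrite mulr_sumr; apply: ler_sum => i _; rewrite mulrA.
    by apply: ler_sum => i _; apply: le_trans (ler_norm _) (kN _ _ _ _ _).
  rewrite mulrBr lerBlDr /C; rewrite sumE in sP.
  suff : N%:R * (\sum_(i < n) l i * P (f i)) -
      \sum_(i < n) (k N i)%:R * P (f i) <= \sum_(i < n) `|P (f i)| by lra.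
  rewrite mulr_sumr -sumrB; apply: ler_sum => i _; rewrite mulrA.
  by apply: le_trans (ler_norm _) _; rewrite distrC; exact: kN.
(* A positive gap multiplied by a large enough [N] would exceed [C]. *)
rewrite leNgt; apply/negP; rewrite -subr_gt0 => d0.
have := bnd (Num.truncn (C / (\sum_(i < n) l i * P (f i) - S))).+1.
by rewrite -ler_pdivlMr// leNgt truncnS_gt.
Qed.

(** The supremum is a true one: by [asl_cone], any upper bound of [g] bounds the values of all
    combinations below [g]. *)
Lemma lower_ext_ge g a n (l : 'I_n -> R) (f : 'I_n -> gamble X R) :
  (forall i, 0 <= l i) -> (forall i, K (f i)) ->
  (forall x, a + \sum_(i < n) l i * f i x <= g x) ->
  a + \sum_(i < n) l i * P (f i) <= lower_ext K P g.
Proof.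
move=> l0 fK fg; apply: ub_le_sup; last by exists a, n, l, f; split.
have [M gM] := gamble_bound g.
exists M => _ [b [m [k [h [k0 hK hg ->]]]]].
rewrite -lerBrDl; apply: asl_cone => // x; rewrite lerBrDl.
exact: le_trans (hg x) (le_trans (ler_norm _) (gM x)).
Qed.

Lemma lower_ext_le g c :
  (forall a n (l : 'I_n -> R) (f : 'I_n -> gamble X R),
    (forall i, 0 <= l i) -> (forall i, K (f i)) ->
    (forall x, a + \sum_(i < n) l i * f i x <= g x) ->
    a + \sum_(i < n) l i * P (f i) <= c) ->
  lower_ext K P g <= c.
Proof.
move=> gc; apply: ge_sup; last first.
  by move=> _ [a [n [l [f [? ? ? ->]]]]]; exact: gc.
have [M gM] := gamble_bound g.
(* The constant [- M] with the empty combination lies below [g], so the supremum is over a non-empty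
   set. *)
exists (- M), (- M), 0%N, (fun=> 0), (fun=> 0).
split=> [|[]//||]; rewrite ?big_ord0 ?addr0// => x.
by rewrite big_ord0 addr0; have := gM x; rewrite ler_norml => /andP[].
Qed.

Lemma lower_ext_ge_lb g c : (forall x, c <= g x) -> c <= lower_ext K P g.
Proof.
move=> cg; have := @lower_ext_ge g c 0 (fun=> 0) (fun=> 0).
by rewrite big_ord0 addr0; apply=> [|[]//|x]//; rewrite big_ord0 addr0.
Qed.

Lemma lower_ext_domain f : K f -> P f <= lower_ext K P f.
Proof.
move=> Kf; have := @lower_ext_ge f 0 1 (fun=> 1) (fun=> f).
by rewrite big_ord1 add0r mul1r; apply=> // x; rewrite big_ord1 add0r mul1r.
Qed.

Lemma lower_ext_mono f g : (forall x, f x <= g x) ->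
  lower_ext K P f <= lower_ext K P g.
Proof.
move=> fg; apply: lower_ext_le => a n l h l0 hK hf.
by apply: lower_ext_ge => // x; exact: le_trans (hf x) (fg x).
Qed.

Lemma lower_extZ (t : R) g : 0 <= t ->
  t * lower_ext K P g <= lower_ext K P (t *: g).
Proof.
rewrite le_eqVlt => /predU1P[<-|t0].
  by rewrite mul0r; apply: lower_ext_ge_lb => x; rewrite gambleZ mul0r.
rewrite mulrC -ler_pdivlMr//; apply: lower_ext_le => a n l f l0 fK fg.
have tE (u : 'I_n -> R) :
    (a + \sum_(i < n) l i * u i) * t = a * t + \sum_(i < n) l i * t * u i.
  rewrite mulrDl mulr_suml; congr (_ + _); apply: eq_bigr => i _.
  by rewrite mulrAC.
rewrite ler_pdivlMr// tE; apply: lower_ext_ge => // [i|x].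
  by rewrite mulr_ge0// ltW.
by rewrite -tE gambleZ mulrC ler_pM2l.
Qed.

Lemma lower_extD f g :
  lower_ext K P f + lower_ext K P g <= lower_ext K P (f + g).
Proof.
rewrite -lerBrDr; apply: lower_ext_le => a n l u l0 uK uf.
rewrite lerBrDr -lerBrDl; apply: lower_ext_le => b m k v k0 vK vg.
rewrite lerBrDl.
(* The two combinations are juxtaposed. In [sumE] the functional [h] stands both for [P] and for
   evaluation at a point. *)
pose lk (i : 'I_(n + m)) :=
  match fintype.split i with inl j => l j | inr j => k j end.
pose uv (i : 'I_(n + m)) :=
  match fintype.split i with inl j => u j | inr j => v j end.
have sumE (h : gamble X R -> R) :
    a + (\sum_(i < n) l i * h (u i)) + (b + \sum_(i < m) k i * h (v i)) =
    a + b + \sum_(i < n + m) lk i * h (uv i).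
  rewrite big_split_ord addrACA; congr (_ + (_ + _)); apply: eq_bigr => i _.
    by rewrite /lk /uv (unsplitK (inl i)).
  by rewrite /lk /uv (unsplitK (inr i)).
rewrite sumE; apply: lower_ext_ge => [i|i|x].
- by rewrite /lk; case: fintype.split.
- by rewrite /uv; case: fintype.split.
- by rewrite -(sumE (fun h => h x)) lerD.
Qed.

Lemma upper_ext_sublinear : sublinear (upper_ext K P).
Proof.
split=> [f g|t f t0]; rewrite /upper_ext.
  by have := lower_extD (- f) (- g); rewrite -opprD; lra.
by have := lower_extZ (- f) t0; rewrite scalerN; lra.
Qed.

Lemma upper_ext_mono f g : (forall x, f x <= g x) ->
  upper_ext K P f <= upper_ext K P g.
Proof.
by move=> fg; rewrite lerN2; apply: lower_ext_mono => x; rewrite !gambleN lerN2.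
Qed.

(** Superadditivity of the lower extension at [- g = (f - g) + (- f)]. *)
Lemma lower_ext_sub_le f g :
  lower_ext K P (f - g) <= upper_ext K P f - upper_ext K P g.
Proof.
have := lower_extD (f - g) (- f); rewrite addrAC subrr add0r.
by rewrite /upper_ext; lra.
Qed.

Lemma lower_le_upper_ext f : lower_ext K P f <= upper_ext K P f.
Proof.
have := lower_ext_sub_le f 0.
by rewrite subr0 (sublinear0 upper_ext_sublinear) subr0.
Qed.

(** Subadditivity at [f = (f - g) + g]. The bound is a seminorm of the tau-topology, so this
    expresses tau-continuity. *)
Lemma upper_ext_lipschitz f g :
  upper_ext K P f - upper_ext K P g <= upper_ext K P (abs_gamble (f - g)).
Proof.
have := upper_ext_sublinear.1 (f - g) g.
rewrite subrK -lerBlDr => /le_trans; apply.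
by apply: upper_ext_mono => x; exact: ler_norm.
Qed.

Lemma lower_ext_lipschitz f g :
  lower_ext K P f - lower_ext K P g <= upper_ext K P (abs_gamble (f - g)).
Proof.
have := upper_ext_lipschitz (- g) (- f).
by rewrite {1 2}/upper_ext !opprK (addrC (- g)); lra.
Qed.

(** These are the linear previsions on all gambles, measurable or not. *)
Definition is_expectation (E : gamble X R -> R) :=
  [/\ linear_for *%R E, forall f, (forall x, 0 <= f x) -> 0 <= E f &
      E (cst_gamble 1) = 1].

(** A linear functional below the upper extension is, by conjugacy, above the lower one; positivity,
    normalization and domination of [P] follow. *)
Lemma asl_expectation :
  exists2 E, is_expectation E & forall f, K f -> P f <= E f.
Proof.
have [E linE EU] := hahn_banach_sublinear upper_ext_sublinear.
have EN f : E (- f) = - E f.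
  have E0 : E 0 = 0 by have := linE 1 0 0; rewrite scale1r addr0 mul1r; lra.
  by have := linE (-1) f 0; rewrite addr0 scaleN1r E0; lra.
have LE f : lower_ext K P f <= E f.
  by have := EU (- f); rewrite EN /upper_ext opprK; lra.
exists E; last by move=> f Kf; exact: le_trans (lower_ext_domain Kf) (LE f).
split=> // [f f0|]; first by apply: le_trans (LE f); exact: lower_ext_ge_lb.
apply/eqP; rewrite eq_le; apply/andP; split.
  apply: le_trans (EU _) _; rewrite lerNl; apply: lower_ext_ge_lb => x.
  by rewrite gambleN.
by apply: le_trans (LE _); exact: lower_ext_ge_lb.
Qed.

End NaturalExtension.

(** * Properties of linear previsions *)

Section Expectation.
Context {X : pointedType} {R : realType}.
Implicit Types (E : gamble X R -> R) (f g : gamble X R).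

Lemma indic_gamble_bounded (A : set X) : \1_A \in @bounded_pred X R.
Proof.
apply/bounded_predP; exists 1 => x; rewrite indicE.
by case: (x \in A); rewrite ?normr1// normr0.
Qed.

Definition indic_gamble (A : set X) : gamble X R :=
  Gamble (indic_gamble_bounded A).

Lemma indicUd (A B : set X) (x : X) : A `&` B = set0 ->
  \1_(A `|` B) x = \1_A x + \1_B x :> R.
Proof.
move=> AB0; rewrite !indicE in_setU.
have [/set_mem Ax|] := boolP (x \in A); have [/set_mem Bx|] := boolP (x \in B);
  rewrite /= ?addr0 ?add0r//.
by have : (A `&` B) x by []; rewrite AB0.
Qed.

Lemma indic_bigsetU (F : nat -> set X) n (x : X) : trivIset setT F ->
  \1_(\big[setU/set0]_(k < n) F k) x = \sum_(k < n) \1_(F k) x :> R.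
Proof.
move=> tF; elim: n => [|n IH]; first by rewrite !big_ord0 indic0.
rewrite !big_ord_recr/= -IH indicUd//.
rewrite -bigcup_mkord; apply/seteqP; split=> // y [[k /= kn Fky] Fny].
have := tF k n Logic.I Logic.I; move: kn => /[swap] -> //; last by exists y.
by rewrite ltnn.
Qed.

Section Properties.
Variable E : gamble X R -> R.
Hypothesis expE : is_expectation E.

Let linE : linear_for *%R E. Proof. by case: expE. Qed.

Lemma expectation0 : E 0 = 0.
Proof. by have := linE 1 0 0; rewrite scale1r addr0 mul1r; lra. Qed.

Lemma expectationZ (a : R) f : E (a *: f) = a * E f.
Proof. by have := linE a f 0; rewrite !addr0 expectation0 addr0. Qed.

Lemma expectationD f g : E (f + g) = E f + E g.
Proof. by have := linE 1 f g; rewrite scale1r mul1r. Qed.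

Lemma expectationB f g : E (f - g) = E f - E g.
Proof. by rewrite expectationD -scaleN1r expectationZ mulN1r. Qed.

Lemma expectation_sum n (a : 'I_n -> R) (f : 'I_n -> gamble X R) :
  E (\sum_(i < n) a i *: f i) = \sum_(i < n) a i * E (f i).
Proof.
rewrite (big_morph E expectationD expectation0).
by apply: eq_bigr => i _; rewrite expectationZ.
Qed.

Lemma expectation_cst c : E (cst_gamble c) = c.
Proof.
have [_ _ E1] := expE; rewrite -[RHS]mulr1 -E1 -expectationZ; congr E.
by apply: gamble_ext => x; rewrite gambleZ mulr1.
Qed.

Lemma expectation_mono f g : (forall x, f x <= g x) -> E f <= E g.
Proof.
have [_ E0 _] := expE; move=> fg; rewrite -subr_ge0 -expectationB.
by apply: E0 => x; rewrite gambleD gambleN subr_ge0.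
Qed.

Lemma expectation_dist_le f g c : (forall x, `|f x - g x| <= c) ->
  `|E f - E g| <= c.
Proof.
move=> fgc; rewrite -expectationB ler_norml.
rewrite -[X in X <= _ <= _](expectation_cst (- c)).
rewrite -[X in _ <= _ <= X](expectation_cst c).
apply/andP; split; apply: expectation_mono => x; rewrite gambleD gambleN/=;
  by have := fgc x; rewrite ler_norml => /andP[].
Qed.

(** [E] is applied to both sides of each inequality that defines the lower extension. *)
Lemma expectation_ge_lower_ext (K : set (gamble X R)) (P : gamble X R -> R) g :
  avoids_sure_loss K P -> (forall f, K f -> P f <= E f) ->
  lower_ext K P g <= E g.
Proof.
move=> asl PE; apply: lower_ext_le => a n l f l0 fK fg.
have -> : a + \sum_(i < n) l i * P (f i) =
    E (cst_gamble a) + \sum_(i < n) l i * P (f i) by rewrite expectation_cst.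
apply: le_trans (_ : _ <= E (cst_gamble a + \sum_(i < n) l i *: f i)) _.
  rewrite expectationD expectation_sum lerD2l; apply: ler_sum => i _.
  by rewrite ler_wpM2l// PE.
apply: expectation_mono => x; rewrite gambleD gamble_sum; exact: fg.
Qed.

Lemma expectation_lipschitz (K : set (gamble X R)) (P : gamble X R -> R) f g :
  avoids_sure_loss K P -> (forall h, K h -> P h <= E h) ->
  E f - E g <= upper_ext K P (abs_gamble (f - g)).
Proof.
move=> asl PE; rewrite -expectationB; set h := abs_gamble _.
apply: le_trans (_ : _ <= E h) _.
  by apply: expectation_mono => x; exact: ler_norm.
rewrite /upper_ext lerNr; apply: le_trans (expectation_ge_lower_ext _ asl PE) _.
by rewrite -scaleN1r expectationZ mulN1r.
Qed.

End Properties.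
End Expectation.

(** * Existence and uniqueness of the Dunford integral *)

Section Dunford.
Context {d : measure_display} {X : algebraOfSetsType d} {R : realType}.
Implicit Types (mu : {content set X -> \bar R}) (E : gamble X R -> R).
Implicit Types (f g : gamble X R).

Lemma simple_measurable_gamble f : simple_gamble f -> measurable_gamble f.
Proof.
move=> sf; exists (fun=> f) => // U Uf.
by exists 0%N => // n _; exact: nbhs_singleton Uf.
Qed.

Lemma measurable_gamble_approx f (e : R) : measurable_gamble f -> 0 < e ->
  exists2 g, simple_gamble g & forall x, `|f x - g x| < e.
Proof.
move=> [s s_simple s_cvg] e0.
have [|N _ sN] := s_cvg [set h | forall x, `|f x - h x| < e].
  apply/uniform_nbhs; exists [set xy | ball xy.1 e xy.2].
  split=> [|h fh x]; last exact: fh.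
  exact: (entourage_ball R (PosNum e0)).
by exists (s N) => //; apply: sN => /=.
Qed.

(** The two functionals agree on simple gambles, which are uniformly dense among the measurable
    ones, and both are continuous. *)
Lemma dunford_integral_unique mu E E' f :
  is_dunford_integral mu E -> is_dunford_integral mu E' ->
  measurable_gamble f -> E f = E' f.
Proof.
move=> [_ Ec Es] [_ Ec' Es'] mf; apply/eqP; rewrite -subr_eq0 -normr_eq0.
rewrite eq_le normr_ge0 andbT; apply/ler_addgt0Pl => e e0; rewrite addr0.
have e20 : 0 < e / 2 by rewrite divr_gt0.
have [r r0 Er] := Ec f mf _ e20; have [r' r'0 Er'] := Ec' f mf _ e20.
(* Pointwise strict bounds give only a weak bound on the supremum; halving makes it strict again. *)
have m0 : 0 < Num.min r r' / 2 by rewrite divr_gt0// lt_min r0.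
have [g sg fg] := measurable_gamble_approx mf m0.
have gf : sup_norm (g - f) < Num.min r r'.
  apply: le_lt_trans (_ : _ <= Num.min r r' / 2) _; last by move: m0; lra.
  apply: (sup_norm_le point) => x.
  by rewrite gambleD gambleN distrC; exact/ltW/fg.
have mg := simple_measurable_gamble sg.
have EE' : E g = E' g.
  by have [n [a [A gaA]]] := sg; rewrite (Es _ _ _ _ gaA) (Es' _ _ _ _ gaA).
move: gf; rewrite lt_min => /andP[/(Er g mg) + /(Er' g mg)].
rewrite EE' !ltr_norml => /andP[? ?] /andP[? ?].
by rewrite ler_norml; apply/andP; split; lra.
Qed.

Lemma expectation_dunford_integral mu E : is_expectation E ->
  (forall A, measurable A -> E (indic_gamble A) = fine (mu A)) ->
  is_dunford_integral mu E.
Proof.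
move=> expE Emu; split=> [a f g _ _|f _ e e0|f n a A [mA fE]].
- by rewrite (expectationD expE) (expectationZ expE).
(* [E] is 1-Lipschitz for the supremum norm. *)
- exists e => // g _ gf; apply: le_lt_trans gf.
  by apply: (expectation_dist_le expE) => x; exact: sup_norm_ub (g - f) x.
- under eq_bigr do rewrite -Emu//; rewrite -(expectation_sum expE); congr E.
  by apply: gamble_ext => x; rewrite fE gamble_sum.
Qed.

Section Existence.
Variable mu : {content set X -> \bar R}.
Hypothesis mu1 : fa_probability mu.

Let m A := fine (mu A).

Let fin_mu A : measurable A -> mu A \is a fin_num.
Proof.
move=> mA; rewrite ge0_fin_numE ?measure_ge0//.
apply: le_lt_trans (_ : _ <= mu setT)%E _; last by rewrite mu1 ltry.
by apply: le_measure; rewrite ?inE//; exact: measurableT.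
Qed.

Let m_split A B : measurable A -> measurable B ->
  m A = m (A `\` B) + m (A `&` B).
Proof.
move=> mA mB; rewrite /m (measureDI mu mA mB) fineD//; apply: fin_mu.
  exact: measurableD.
exact: measurableI.
Qed.

(* Positivity of the integral of simple functions, localized to [B] so that the
   induction can split [B] along the first set. *)
Lemma fa_simple_ge0 n (a : 'I_n -> R) (A : 'I_n -> set X) c B :
  (forall i, measurable (A i)) -> measurable B ->
  (forall x, B x -> 0 <= c + \sum_(i < n) a i * \1_(A i) x) ->
  0 <= c * m B + \sum_(i < n) a i * m (A i `&` B).
Proof.
elim: n => [|n IH] in a A c B *; move=> mA mB.
  rewrite big_ord0 addr0 => c0; have [->|/set0P[x Bx]] := eqVneq B set0.
    by rewrite /m measure0 mulr0.
  have := c0 x Bx; rewrite big_ord0 addr0 => ?.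
  by rewrite mulr_ge0// fine_ge0// measure_ge0.
move=> aA; set A0 := A ord0; have mA0 : measurable A0 by exact: mA.
(* On [A0] the coefficient [a ord0] joins the constant; off [A0] its term vanishes. *)
have := IH (fun i => a (lift ord0 i)) (fun i => A (lift ord0 i))
  (c + a ord0) (B `&` A0) (fun=> mA _) (measurableI _ _ mB mA0).
have := IH (fun i => a (lift ord0 i)) (fun i => A (lift ord0 i))
  c (B `\` A0) (fun=> mA _) (measurableD mB mA0).
rewrite big_ord_recl -/A0 (m_split mB mA0) (setIC A0).
have -> : \sum_(i < n) a (lift ord0 i) * m (A (lift ord0 i) `&` B) =
    \sum_(i < n) a (lift ord0 i) * m (A (lift ord0 i) `&` (B `\` A0)) +
    \sum_(i < n) a (lift ord0 i) * m (A (lift ord0 i) `&` (B `&` A0)).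
  rewrite -big_split; apply: eq_bigr => i _ /=.
  rewrite (m_split (measurableI _ _ (mA _) mB) mA0).
  by rewrite setIDA setIA mulrDr.
move=> H1 H2.
suff: 0 <= c * m (B `\` A0) + \sum_(i < n) a (lift ord0 i) *
      m (A (lift ord0 i) `&` (B `\` A0)) /\
    0 <= (c + a ord0) * m (B `&` A0) + \sum_(i < n) a (lift ord0 i) *
      m (A (lift ord0 i) `&` (B `&` A0)) by move=> [? ?]; lra.
split; [apply: H1 | apply: H2] => x [Bx A0x]; have := aA x Bx.
  by rewrite big_ord_recl indicE -/A0 memNset// mulr0 add0r.
by rewrite big_ord_recl indicE -/A0 mem_set// mulr1 addrA.
Qed.

Lemma fa_expectation : exists2 E, is_expectation E & is_dunford_integral mu E.
Proof.
pose K := [set f | exists2 A, measurable A & f = @indic_gamble X R A].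
(* An indicator equals 1 exactly on its set, so [P] recovers the measure from the gamble alone. *)
pose P (f : gamble X R) := m [set x | f x = 1].
have PE A : P (indic_gamble A) = m A.
  congr m; apply/seteqP; split=> x /=; rewrite indicE.
    have [/set_mem//|_ /eqP] := boolP (x \in A).
    by rewrite eq_sym oner_eq0.
  by move=> /mem_set ->.
have asl : avoids_sure_loss K P.
  move=> [n [f [fK]]]; apply/negP; rewrite -leNgt; set S := sup _.
  have fS x : \sum_(i < n) f i x <= S.
    apply: ub_le_sup; last by exists x.
    have [M fM] := gamble_bound (\sum_(i < n) f i).
    exists M => _ [y _ <-]; apply: le_trans (fM y).
    by rewrite gamble_sum ler_norm.
  pose A i := s2val (cid2 (fK i)).
  have mA i : measurable (A i) by exact: s2valP (cid2 (fK i)).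
  have fA i : f i = indic_gamble (A i) by exact: s2valP' (cid2 (fK i)).
  suff : \sum_(i < n) m (A i) <= S.
    by apply: le_trans; apply: ler_sum => i _; rewrite fA PE.
  (* This is the shape of [fa_simple_ge0] on the whole space, with constant [S] and all coefficients
     [-1]. *)
  have -> : \sum_(i < n) m (A i) = - \sum_(i < n) (-1) * m (A i `&` setT).
    by rewrite -sumrN; apply: eq_bigr => i _; rewrite mulN1r opprK setIT.
  rewrite lerNl -subr_ge0 opprK addrC.
  have := @fa_simple_ge0 n (fun=> -1) A S setT mA (@measurableT _ _).
  rewrite {1}/m mu1/= mulr1; apply=> x _.
  rewrite -mulr_sumr mulN1r subr_ge0; apply: le_trans (fS x).
  by apply: ler_sum => i _; rewrite fA.
have [E expE PleE] := asl_expectation asl.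
have mE A : measurable A -> m A <= E (indic_gamble A).
  by move=> mA; rewrite -PE; apply: PleE; exists A.
exists E => //; apply: expectation_dunford_integral => // A mA.
(* The reverse inequality is the lower bound for the complement, both sides summing to 1 over [A]
   and its complement. *)
apply/eqP; rewrite eq_le mE// andbT.
have := mE _ (measurableC mA); have := m_split (@measurableT _ X) mA.
rewrite setTD setTI {1}/m mu1/=.
have : E (indic_gamble A) + E (indic_gamble (~` A)) = 1.
  rewrite -(expectationD expE) -[RHS](expectation_cst expE); congr E.
  apply: gamble_ext => x; rewrite gambleD/= -indicUd ?setICr//.
  by rewrite setUv indicT.
by rewrite -/(m A); lra.
Qed.

(** By uniqueness, the functional chosen by [xget] agrees on measurable gambles with an expectation,
    which is monotone on all gambles. *)
Lemma dunford_expectation :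
  exists2 E, is_expectation E &
    forall f, measurable_gamble f -> dunford mu f = E f.
Proof.
have [E expE dE] := fa_expectation; exists E => // f mf.
apply: dunford_integral_unique mf; last exact: dE.
by apply: (@xgetPex _ _ [set E | is_dunford_integral mu E]); exists E.
Qed.

End Existence.

(** * The finitely additive probability induced by a linear prevision *)

Section ContentOfExpectation.
Variable E : gamble X R -> R.
Hypothesis expE : is_expectation E.

Definition expectation_content (A : set X) : \bar R := (E (indic_gamble A))%:E.

Let expectation_content_ge0 A : (0 <= expectation_content A)%E.
Proof.
rewrite lee_fin; have [_ + _] := expE; apply=> x /=.
by rewrite indicE ler0n.
Qed.

Let expectation_content_additive :
  measure_function.semi_additive expectation_content.
Proof.
move=> F n _ tF _; rewrite /expectation_content sumEFin; congr EFin.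
rewrite -(big_morph E (expectationD expE) (expectation0 expE)); congr E.
by apply: gamble_ext => x; rewrite gamble_sum/= indic_bigsetU.
Qed.

#[local] HB.instance Definition _ := isContent.Build d X R expectation_content
  expectation_content_ge0 expectation_content_additive.

Lemma expectation_fa_probability :
  exists2 mu, fa_probability mu & is_dunford_integral mu E.
Proof.
exists expectation_content; last by apply: expectation_dunford_integral.
rewrite /fa_probability /= /expectation_content; congr EFin.
rewrite -[RHS](expectation_cst expE); congr E.
by apply: gamble_ext => x /=; rewrite indicT.
Qed.

End ContentOfExpectation.

(** By uniqueness, the Dunford integral of the probability induced by [E] is [E] itself on the
    measurable gambles, in particular on [K]. *)
Lemma credal_set_nonempty (K : set (gamble X R)) (P : gamble X R -> R) :
  avoids_sure_loss K P -> (forall f, K f -> measurable_gamble f) ->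
  credal_set K P !=set0.
Proof.
move=> asl mK; have [E expE PE] := asl_expectation asl.
have [mu mu1 dE] := expectation_fa_probability expE.
exists mu; split=> // f Kf; rewrite (le_trans (PE f Kf))//.
have dmu : is_dunford_integral mu (dunford mu).
  by apply: (@xgetPex _ _ [set E | is_dunford_integral mu E]); exists E.
by rewrite (dunford_integral_unique dE dmu (mK f Kf)).
Qed.

End Dunford.

(** * Closed sets of the tau-topology *)

Section TauTopology.
Context {X : pointedType} {R : realType}.
Variables (K : set (gamble X R)) (P : gamble X R -> R).
Hypothesis asl : avoids_sure_loss K P.
Implicit Types f g : gamble X R.

Lemma tau_ball_nbhs p f (e : R) : tau_seminorm K P p -> 0 < e ->
  nbhs (f : tau_gamble K P) (tau_ball p f e).
Proof.
move=> sp e0; apply: open_nbhs_nbhs; split.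
  exists [set (tau_ball p f e : set (tau_gamble K P))]; last first.
    by rewrite bigcup_set1.
  by move=> _ ->; apply: (@finI_from1 _ _ _ id); exists p, f, e.
rewrite /tau_ball /= subrr; case: sp => [[x ->]|->]; first by rewrite normr0.
suff -> : abs_gamble (0 : gamble X R) = 0.
  by rewrite (sublinear0 (upper_ext_sublinear asl)).
by apply: gamble_ext => x /=; rewrite normr0.
Qed.

(** One seminorm is enough in both uses: a point evaluation for the pointwise order, the upper
    extension for Lipschitz functionals. *)
Lemma tau_closed (A : set (tau_gamble K P)) :
  (forall f, ~ A f -> exists p (e : R), [/\ tau_seminorm K P p, 0 < e &
    forall g, p (g - f : gamble X R) < e -> ~ A g]) ->
  closed A.
Proof.
move=> nA; rewrite closedE => f /= Af; apply: contrapT => /nA[p [e [sp e0 pA]]].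
by apply: Af; apply: filterS (tau_ball_nbhs f sp e0) => g; exact: pA.
Qed.

Lemma tau_closed_ge_gamble f : closed [set g : tau_gamble K P | ge_gamble g f].
Proof.
apply: tau_closed => g /existsNP[x] /negP; rewrite -ltNge => gf.
(* The radius is the gap at a point [x] where the inequality fails. *)
exists (fun h : gamble X R => `|h x|), (f x - g x); split.
- by left; exists x.
- by rewrite subr_gt0.
- move=> h + /(_ x); rewrite gambleD gambleN ltr_norml => /andP[_].
  by move=> ? ?; lra.
Qed.

Lemma tau_closed_lipschitz (u : gamble X R -> R) r :
  (forall f g, u f - u g <= upper_ext K P (abs_gamble (f - g))) ->
  closed [set g : tau_gamble K P | r <= u g].
Proof.
move=> lu; apply: tau_closed => f /negP; rewrite -ltNge => ufr.
exists (fun h => upper_ext K P (abs_gamble h)), (r - u f); split.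
- by right.
- by rewrite subr_gt0.
- by move=> g gf /=; have := lu g f; lra.
Qed.

End TauTopology.

(** * Existence of optimal decisions *)

(* Among the maximizers of [u], which form a compact set, pick one that is
   maximal for the pointwise order; it is admissible because [u] is monotone. *)
Lemma argmax_opt_adm (d : measure_display) (X : algebraOfSetsType d)
    (R : realType) (D : Type) (J : D -> gamble X R)
    (K : set (gamble X R)) (P : gamble X R -> R) (u : gamble X R -> R) :
  avoids_sure_loss K P ->
  range J !=set0 -> @compact (tau_gamble K P) (range J) ->
  (forall f g : gamble X R, (forall x, f x <= g x) -> u f <= u g) ->
  (forall f g : gamble X R, u f - u g <= upper_ext K P (abs_gamble (f - g))) ->
  argmax (opt_adm J) (fun a => u (J a)) !=set0.
Proof.
move=> asl J0 cJ u_mono u_lip.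
have u_closed r := @tau_closed_lipschitz X R K P asl u r u_lip.
(* The preorder induced by [u] is total, so a maximal element maximizes [u] over the range of
   [J]. *)
have [|m Jm um] := @compact_preorder_maximal (tau_gamble K P) (range J)
  (fun f g => u f <= u g) (fun=> lexx _) _ cJ J0 (fun f _ => u_closed (u f)).
  by move=> f g h; exact: le_trans.
pose C : set (tau_gamble K P) := range J `&` [set g | u m <= u g].
have [| | |m' [[a _ <-] /= uma] am] :=
  @compact_preorder_maximal (tau_gamble K P) C
  (fun f g => ge_gamble g f) (fun f x => lexx _) _ _ _
  (fun f _ => @tau_closed_ge_gamble _ _ _ _ asl f).
- by move=> f g h fg gh x; exact: le_trans (gh x).
- exact: compact_closedI.
- by exists m; split => /=.
exists a; split=> b.
  have [ba|] := pselect (ge_gamble (J b) (J a)); [right | by left].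
  apply: gamble_ext => x; apply: le_anti; rewrite ba andbT.
  (* A gain dominating [J a] stays in [C] because [u] is monotone. *)
  apply: am => //; split; first by exists b.
  exact: le_trans uma (u_mono _ _ ba).
move=> _; apply: le_trans uma.
have [umb|/ltW//] := leP (u m) (u (J b)).
by apply: um => //; exists b.
Qed.

Theorem theorem5 (R : realType) (d : measure_display)
    (X : algebraOfSetsType d) (D : Type) (J : D -> gamble X R)
    (K : set (gamble X R)) (P : gamble X R -> R)
    (P_asl : avoids_sure_loss K P)
    (K_meas : forall f, K f -> measurable_gamble f)
    (J_meas : forall a, measurable_gamble (J a))
    (J_neq0 : range J !=set0)
    (J_compact : @compact (tau_gamble K P) (range J)) :
  (forall mu, credal_set K P mu -> opt_meu J mu !=set0) /\
  opt_maximin J K P !=set0 /\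
  opt_maximax J K P !=set0 /\
  opt_maximal J K P !=set0 /\
  opt_interval J K P !=set0 /\
  opt_E_admissible J K P !=set0.
Proof.
have argmaxE u := @argmax_opt_adm d X R D J K P u P_asl J_neq0 J_compact.
have meu mu : credal_set K P mu -> opt_meu J mu !=set0.
  move=> [mu1 Pmu]; have [E expE dE] := dunford_expectation mu1.
  (* All gains are measurable, so [dunford mu] can be replaced by [E], to which [argmaxE]
     applies. *)
  rewrite /opt_meu; under [X in argmax _ X]funext do rewrite dE//.
  apply: argmaxE => [f g|f g]; first exact: (expectation_mono expE).
  apply: (expectation_lipschitz expE) => // h Kh.
  by rewrite -dE ?Pmu//; exact: K_meas.
have [a [adm_a max_a]] : opt_maximax J K P !=set0.
  apply: argmaxE => [f g|f g]; first exact: upper_ext_mono.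
  exact: upper_ext_lipschitz.
split; first exact: meu.
split.
  apply: argmaxE => [f g|f g]; first exact: lower_ext_mono.
  exact: lower_ext_lipschitz.
split; first by exists a.
split.
  exists a; split=> // b adm_b; apply: le_trans (lower_ext_sub_le P_asl _ _) _.
  by rewrite subr_le0 max_a.
split.
  exists a; split=> // b adm_b.
  exact: le_trans (lower_le_upper_ext P_asl _) (max_a _ adm_b).
have [mu Mmu] := credal_set_nonempty P_asl K_meas.
by have [c cmu] := meu mu Mmu; exists c, mu.
Qed.
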